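(* Let $\mathcal{A}$ be a unital Banach $*$-algebra with unit $I$, let $\mathcal{M}$ be a unital $*$-$\mathcal{A}$-bimodule, and let $W$ be a fixed element of $\mathcal{A}$. If $\delta:\mathcal{A}\to\mathcal{M}$ is a linear mapping with $\delta(I)=0$ and $$A,B\in\mathcal{A},\ AB^*=W \quad\Longrightarrow\quad \delta(W)=A\delta(B)^*+B^*\delta(A),$$ then the mapping $W\delta:\mathcal{A}\to\mathcal{M}$, $A\mapsto W\delta(A)$, is a Jordan left derivation.
   Context: Algebras are over the real or complex field. A $*$-$\mathcal{A}$-bimodule over a $*$-algebra $\mathcal{A}$ is an $\mathcal{A}$-bimodule $\mathcal{M}$ with a conjugate-linear map $M\mapsto M^*$ satisfying $M^{**}=M$, $(AM)^*=M^*A^*$, $(MA)^*=A^*M^*$ for $A\in\mathcal{A}$, $M\in\mathcal{M}$; it is unital if $IM=MI=M$. $\delta(B)^*$ means $(\delta(B))^*$. No continuity of $\delta$ is assumed. A linear mapping $\eta:\mathcal{A}\to\mathcal{M}$ is a Jordan left derivation if $\eta(A^2)=2A\eta(A)$ for each $A\in\mathcal{A}$. *)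

(* Defs.v *)
From HB Require Import structures.
From mathcomp Require Import all_boot all_order all_algebra.
From mathcomp Require Import all_classical all_reals all_analysis.
From mathcomp Require Import complex.

Set Implicit Arguments.
Unset Strict Implicit.
Unset Printing Implicit Defensive.

Import Order.TTheory GRing.Theory Num.Theory.
Import numFieldNormedType.Exports.

Local Open Scope ring_scope.

Variant ground_field := RealField | ComplexField.

Definition scalars (R : realType) (k : ground_field) : numFieldType :=
  match k with
  | RealField => R
  | ComplexField => R[i]
  end.

Definition scalar_conj (R : realType) (k : ground_field) :
    scalars R k -> scalars R k :=
  match k return scalars R k -> scalars R k with
  | RealField => id
  | ComplexField => fun z : R[i] => conjc z
  end.

(* A *-algebra over a field K with a conjugation c; "conjugate-linear" below
   always refers to c, so that c = id gives linear involutions. *)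
HB.mixin Record Algebra_isStarAlgebra (K : numFieldType) (c : K -> K) A
    of GRing.Algebra K A := {
  star : A -> A;
  starD : forall x y : A, star (x + y) = star x + star y;
  starZ : forall (l : K) (x : A), star (l *: x) = c l *: star x;
  starM : forall x y : A, star (x * y) = star y * star x;
  starK : forall x : A, star (star x) = x
}.

#[short(type="starAlgType")]
HB.structure Definition StarAlgebra (K : numFieldType) (c : K -> K) :=
  {A of GRing.Algebra K A & Algebra_isStarAlgebra K c A}.

(* A submultiplicative norm, with values in K as everywhere in the library.
   `|1| = 1 is not required. *)
Record algebra_norm (K : numFieldType) (A : algType K) := AlgebraNorm {
  anorm :> A -> K;
  anormD : forall x y : A, anorm (x + y) <= anorm x + anorm y;
  anormZ : forall (l : K) (x : A), anorm (l *: x) = `|l| * anorm x;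
  anorm0_eq0 : forall x : A, anorm x = 0 -> x = 0;
  anormM : forall x y : A, anorm (x * y) <= anorm x * anorm y
}.

(* The vector space underlying A, as a normed module for the norm N. The alias
   keeps the normed module structure off the ring A itself: Hierarchy Builder
   rejects a structure joining algType and normedModType, because numDomainType
   inherits from both rings and normed groups. *)
Definition normed_by (K : numFieldType) (A : algType K)
  (N : algebra_norm A) : Type := A.

HB.instance Definition _ (K : numFieldType) (A : algType K)
  (N : algebra_norm A) := GRing.Lmodule.copy (normed_by N) A.

HB.instance Definition _ (K : numFieldType) (A : algType K)
  (N : algebra_norm A) := Lmodule_isNormed.Build K (normed_by N)
    (@anormD K A N) (@anormZ K A N) (@anorm0_eq0 K A N).

HB.mixin Record Algebra_isBanach (K : numFieldType) A of GRing.Algebra K A := {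
  banach_norm : algebra_norm A;
  banach_complete : forall F : set_system (normed_by banach_norm),
    ProperFilter F -> cauchy F -> cvg F
}.

#[short(type="banachAlgType")]
HB.structure Definition BanachAlgebra (K : numFieldType) :=
  {A of GRing.Algebra K A & Algebra_isBanach K A}.

(* Continuity of the involution is not required. *)
#[short(type="banachStarAlgType")]
HB.structure Definition BanachStarAlgebra (K : numFieldType) (c : K -> K) :=
  {A of BanachAlgebra K A & Algebra_isStarAlgebra K c A}.

(* The actions are not library module structures: M is already an lmodType
   over K, and it carries an action of A on each side. *)
HB.mixin Record Lmodule_isBimodule (K : numFieldType) (A : algType K) M
    of GRing.Lmodule K M := {
  lact : A -> M -> M;
  ract : M -> A -> M;
  lactDl : forall (a b : A) (m : M), lact (a + b) m = lact a m + lact b m;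
  lactDr : forall (a : A) (m n : M), lact a (m + n) = lact a m + lact a n;
  lactZl : forall (l : K) (a : A) (m : M), lact (l *: a) m = l *: lact a m;
  lactZr : forall (l : K) (a : A) (m : M), lact a (l *: m) = l *: lact a m;
  lactA : forall (a b : A) (m : M), lact (a * b) m = lact a (lact b m);
  ractDl : forall (m n : M) (a : A), ract (m + n) a = ract m a + ract n a;
  ractDr : forall (m : M) (a b : A), ract m (a + b) = ract m a + ract m b;
  ractZl : forall (l : K) (m : M) (a : A), ract (l *: m) a = l *: ract m a;
  ractZr : forall (l : K) (m : M) (a : A), ract m (l *: a) = l *: ract m a;
  ractA : forall (m : M) (a b : A), ract m (a * b) = ract (ract m a) b;
  lractA : forall (a : A) (m : M) (b : A),
    ract (lact a m) b = lact a (ract m b)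
}.

#[short(type="bimodType")]
HB.structure Definition Bimodule (K : numFieldType) (A : algType K) :=
  {M of GRing.Lmodule K M & Lmodule_isBimodule K A M}.

HB.mixin Record Bimodule_isStarBimodule (K : numFieldType) (c : K -> K)
    (A : starAlgType c) M of Bimodule K A M := {
  mstar : M -> M;
  mstarD : forall m n : M, mstar (m + n) = mstar m + mstar n;
  mstarZ : forall (l : K) (m : M), mstar (l *: m) = c l *: mstar m;
  mstarK : forall m : M, mstar (mstar m) = m;
  mstar_lact : forall (a : A) (m : M),
    mstar (lact a m) = ract (mstar m) (star a);
  mstar_ract : forall (m : M) (a : A),
    mstar (ract m a) = lact (star a) (mstar m)
}.

#[short(type="starBimodType")]
HB.structure Definition StarBimodule (K : numFieldType) (c : K -> K)
    (A : starAlgType c) :=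
  {M of Bimodule K A M & @Bimodule_isStarBimodule K c A M}.

HB.mixin Record Bimodule_isUnital (K : numFieldType) (A : algType K) M
    of Bimodule K A M := {
  lact1 : forall m : M, lact (1 : A) m = m;
  ract1 : forall m : M, ract m (1 : A) = m
}.

#[short(type="unitalStarBimodType")]
HB.structure Definition UnitalStarBimodule (K : numFieldType) (c : K -> K)
    (A : starAlgType c) :=
  {M of @StarBimodule K c A M & Bimodule_isUnital K A M}.

Definition jordan_left_derivation (K : numFieldType) (A : algType K)
    (M : bimodType A) (eta : A -> M) : Prop :=
  linear eta /\ forall a : A, eta (a ^+ 2) = 2 *: lact a (eta a).

(* Main.v *)
Require Import Defs.
From HB Require Import structures.
From mathcomp Require Import all_boot all_order all_algebra.
From mathcomp Require Import all_classical all_reals all_analysis.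
From mathcomp Require Import complex.
From mathcomp Require Import ring.
Import Order.TTheory GRing.Theory Num.Theory.
Import numFieldNormedType.Exports.
Local Open Scope ring_scope.

(** The hypothesis produces two additive maps from A to M, the map
      eta(a) = W delta(a),     h(v) = v delta(W) - delta((v W)^* )^*,
    linked by an inversion formula.  If u v = v u = 1 then v and u W multiply
    to W, so delta(W) = v delta((u W)^* )^* + u W delta(v), and acting by u gives
      h(u) = u^2 eta(v).                                             (1)
    From here on only the left action matters, and (1), read on the units of A,
    forces the Jordan identity.  Formally this is the comparison of the first
    two orders in t of (1) at u = 1 + t a, which would need continuity; two
    exact partial fraction identities replace the expansion.

    - For u = a (1 - a)^-1 we have u = (1 - a)^-1 - 1 and u^-1 = a^-1 - 1.
      Evaluating (1) on both sides and using (1) again for a and for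
      (1 - a)^-1 yields h(a) = - eta(a)  [inverse_identity_opp,
      inverse_identity_opp_all].
    - For u = a (1 - a) we have u^-1 = a^-1 + (1 - a)^-1, and (1) becomes
      eta(a) - eta(a^2) = (1 - 2 a) eta(a)  [inverse_identity_square].

    Both need a and 1 - a invertible.  Each conclusion holds for a as soon as it
    holds for a + n with n an integer, because eta(1) = h(1) = 0, and a large
    enough n makes both elements invertible: this is the Neumann series,
    the only place where the Banach norm is used. *)

(** * Geometric sequences in the scalars *)

Definition archimedean_field (K : numFieldType) : Prop :=
  forall x : K, 0 <= x -> exists n : nat, x <= n%:R.

(** For complex scalars a nonnegative element is a real number, so the bound
    comes from the real case. *)
Lemma scalars_archimedean (R : realType) (k : ground_field) :
  archimedean_field (scalars R k).
Proof.
case: k => /= x x0.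
  by exists (Num.bound x); apply: ltW; apply: archi_boundP.
case: x x0 => r i; rewrite lecE /= => /andP[/eqP i0 r0].
exists (Num.bound r).
have -> : (Num.bound r)%:R = ((Num.bound r)%:R : R)%:C%C :> R[i].
  by rewrite rmorph_nat.
rewrite i0 lecR.
by apply: ltW; apply: archi_boundP.
Qed.

Lemma geometric_lt (K : numFieldType) (D e : K) : archimedean_field K ->
  0 <= D -> 0 < e -> exists n, D / 2 ^+ n < e.
Proof.
move=> archK D0 e0.
have [|n Dn] := archK (D / e); first by rewrite divr_ge0 // ltW.
exists n; rewrite ltr_pdivrMr ?exprn_gt0 // mulrC -ltr_pdivrMr //.
by apply: le_lt_trans Dn _; rewrite -natrX ltr_nat ltn_expl.
Qed.

Lemma le_geometric_eq0 (K : numFieldType) (y D : K) : archimedean_field K ->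
  0 <= y -> 0 <= D -> (forall n, y <= D / 2 ^+ n) -> y = 0.
Proof.
move=> archK y0 D0 yD; apply/eqP; apply: contraT => yn0.
have yp : 0 < y by rewrite lt_def yn0.
have [n /(le_lt_trans (yD n))] := geometric_lt K D y archK D0 yp.
by rewrite ltxx.
Qed.

(** * Invertible elements of a Banach algebra *)

(** A Banach algebra is not assumed to come with a chosen inverse operation,
    hence a relation rather than a unit predicate. *)
Definition two_sided_inverse {A : pzRingType} (u v : A) : Prop :=
  u * v = 1 /\ v * u = 1.

Section AlgebraNorm.
Context {K : numFieldType} {A : algType K} (N : algebra_norm A).

Lemma anormN x : N (- x) = N x.
Proof. by rewrite -scaleN1r anormZ normrN1 mul1r. Qed.

Lemma anormB x y : N (x - y) <= N x + N y.
Proof. by rewrite -[N y]anormN anormD. Qed.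

Lemma anorm_ge0 x : 0 <= N x.
Proof. exact: (normr_ge0 (x : normed_by N)). Qed.

(** Since N 1 may exceed 1, it has to stay in the bound. *)
Lemma anorm_exprn (x : A) n : N x <= 2^-1 -> N (x ^+ n) <= N 1 / 2 ^+ n.
Proof.
move=> hx; elim: n => [|n IH]; first by rewrite !expr0 divr1.
rewrite !exprSr invfM mulrA.
by apply: le_trans (anormM _ _ _) _; apply: ler_pM => //; apply: anorm_ge0.
Qed.

(** The telescoping form of the right-hand side makes the induction on k
    immediate; forgetting the subtracted term gives the Cauchy estimate. *)
Lemma anorm_sum_geometric (x : A) n k : N x <= 2^-1 ->
  N (\sum_(i < n + k) x ^+ i - \sum_(i < n) x ^+ i)
    <= 2 * N 1 / 2 ^+ n - 2 * N 1 / 2 ^+ (n + k).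
Proof.
move=> hx; elim: k => [|k IH].
  by rewrite addn0 !subrr -(scale0r (1 : A)) anormZ normr0 mul0r.
rewrite addnS big_ord_recr /= addrAC.
apply: le_trans (anormD _ _ _) _.
apply: le_trans (lerD IH (anorm_exprn _ (n + k)%N hx)) _.
rewrite exprS le_eqVlt; apply/orP; left; apply/eqP.
have h : (2 : K) ^+ (n + k) != 0 by rewrite expf_neq0 // pnatr_eq0.
have h' : (2 : K) ^+ n != 0 by rewrite expf_neq0 // pnatr_eq0.
have h2 : (2 : K) != 0 by rewrite pnatr_eq0.
by field; rewrite h h'.
Qed.

End AlgebraNorm.

(** The sum of the geometric series inverts 1 - x.  The estimates are kept
    explicit, with rate 2^-n, so that continuity of the product is not called
    for: the error (1 - x) v - 1 equals (1 - x) (v - s n) - x ^+ n for every n,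
    and likewise on the other side. *)
Lemma neumann_series (K : numFieldType) (A : banachAlgType K) (x : A) :
  archimedean_field K -> banach_norm x <= 2^-1 ->
  exists v, two_sided_inverse (1 - x) v.
Proof.
move=> archK; set N : algebra_norm A := banach_norm => hx.
pose s n : normed_by N := \sum_(i < n) x ^+ i.
pose D := 2 * N 1.
have D0 : 0 <= D by rewrite mulr_ge0 // anorm_ge0.
have sB n m : (n <= m)%N -> `|s m - s n| <= D / 2 ^+ n.
  move=> /subnKC <-; apply: le_trans (anorm_sum_geometric N x n _ hx) _.
  by rewrite gerBl divr_ge0 // exprn_ge0.
have : cvg (s @ \oo)%classic.
  apply: (@banach_complete K A).
  apply/cauchy_exP => e e0.
  have [n nD] := geometric_lt K D e archK D0 e0.
  exists (s n); exists n => // m /= nm.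
  rewrite -ball_normE /= distrC.
  by apply: le_lt_trans nD; apply: sB.
move=> /cvg_ex[/= v sv]; exists v.
(* The extra 1 in D + 1 absorbs the distance from v to a far partial sum. *)
have vs n : N (v - s n) <= (D + 1) / 2 ^+ n.
  have e0 : (0 : K) < 2 ^- n by rewrite invr_gt0 exprn_gt0.
  have [m _ hm] :
      (\forall m \near \oo%classic, `|(v : normed_by N) - s m| < 2 ^- n).
    exact: (@cvgrPdist_lt K (normed_by N) nat \oo%classic _ s v).1 sv _ e0.
  have := hm (maxn m n) (leq_maxl _ _) => h.
  have -> : v - s n = ((s (maxn m n) - s n) + (v - s (maxn m n)) : A).
    by rewrite [RHS]addrC addrA subrK.
  apply: le_trans (anormD _ _ _) _.
  rewrite mulrDl mul1r; apply: lerD; last exact: ltW.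
  exact: sB (leq_maxr _ _).
have sl n : (1 - x) * (s n : A) = 1 - x ^+ n.
  by rewrite -[RHS]opprB subrX1 -mulNr opprB.
have sr n : (s n : A) * (1 - x) = 1 - x ^+ n.
  rewrite -sl /s; elim: n => [|n IH]; first by rewrite big_ord0 mul0r mulr0.
  rewrite big_ord_recr /= [LHS]mulrDl [RHS]mulrDr IH; congr (_ + _).
  by rewrite mulrBl mulrBr mul1r mulr1 -exprS -exprSr.
have fin (r : A) (C : K) :
    (forall n, N r <= C * N (v - s n) + N (x ^+ n)) -> 0 <= C -> r = 0.
  move=> hr C0; apply: (@anorm0_eq0 K A N).
  apply: (le_geometric_eq0 _ _ (C * (D + 1) + N 1)) => //.
  - exact: anorm_ge0.
  - by rewrite addr_ge0 ?anorm_ge0 // mulr_ge0 // addr_ge0.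
  move=> n; apply: le_trans (hr n) _.
  rewrite mulrDl; apply: lerD; last exact: anorm_exprn.
  by rewrite -mulrA; apply: ler_wpM2l.
split; apply/eqP; rewrite -subr_eq0; apply/eqP;
  apply: (fin _ (N (1 - x))) => [n|]; try exact: anorm_ge0.
- have -> : (1 - x) * v - 1 = (1 - x) * (v - s n) - x ^+ n.
    by rewrite mulrBr sl -addrA -opprD subrK.
  by apply: le_trans (anormB _ _ _) _; rewrite lerD2r anormM.
- have -> : v * (1 - x) - 1 = (v - s n) * (1 - x) - x ^+ n.
    by rewrite mulrBl sr -addrA -opprD subrK.
  by apply: le_trans (anormB _ _ _) _; rewrite lerD2r mulrC anormM.
Qed.

Lemma large_shift_invertible (K : numFieldType) (A : banachAlgType K) (a : A)
    (n : nat) : archimedean_field K ->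
  (0 < n)%N -> 2 * banach_norm a <= n%:R ->
  exists v, two_sided_inverse (a + n%:R) v.
Proof.
move=> archK n0 an.
have np : (0 : K) < n%:R by rewrite ltr0n.
have [|v [vl vr]] := @neumann_series K A (- (n%:R^-1 *: a)) archK.
  rewrite anormN anormZ ger0_norm ?invr_ge0 ?ler0n //.
  by rewrite mulrC ler_pdivrMr // mulrC ler_pdivlMr // mulrC.
have -> : a + n%:R = (n%:R : K) *: (1 - - (n%:R^-1 *: a)).
  rewrite opprK scalerDr scalerA mulfV ?gt_eqF // scale1r addrC.
  by rewrite scaler_nat.
exists ((n%:R^-1 : K) *: v); split.
- by rewrite -scalerAl -scalerAr scalerA mulfV ?gt_eqF // scale1r.
- by rewrite -scalerAl -scalerAr scalerA mulVf ?gt_eqF // scale1r.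
Qed.

Lemma banach_shift (K : numFieldType) (A : banachAlgType K) (a : A) :
  archimedean_field K -> exists n : nat,
  (exists v, two_sided_inverse (a + n%:R) v) /\
  (exists v, two_sided_inverse (a + n.+1%:R) v).
Proof.
move=> archK.
have [|n an] := archK (2 * banach_norm a); first by rewrite mulr_ge0 ?anorm_ge0.
by exists n.+1; split; apply: large_shift_invertible => //;
  apply: le_trans an _; rewrite ler_nat // ltnW.
Qed.

(** * Additive maps linked by inversion *)

Section InverseIdentity.
Context {A : pzRingType} {V : lmodType A} (eta h : {additive A -> V}).
Context (eta1 : eta 1 = 0).
Context (h_inverse : forall u v, two_sided_inverse u v ->
  h u = u ^+ 2 *: eta v).

Lemma inverse_identity_one : h 1 = 0.
Proof. by rewrite (h_inverse 1 1) ?eta1 ?scaler0 //; split; rewrite mulr1. Qed.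

(** Here c - 1 = a (1 - a)^-1 has inverse b - 1.  The formula at c - 1 reads
    h(c) = c^2 a^2 eta(b) = c^2 h(a), while at c it reads
    h(c) = c^2 eta(1 - a) = - c^2 eta(a); then c^2 cancels. *)
Lemma inverse_identity_opp (a b c : A) :
  two_sided_inverse a b -> two_sided_inverse (1 - a) c -> h a = - eta a.
Proof.
move=> [ab ba] [dc cd].
have ac : a * c = c - 1.
  by apply/eqP; rewrite eq_sym subr_eq -dc -mulrDl addrC subrK mul1r.
have ca : c * a = c - 1.
  by apply/eqP; rewrite eq_sym subr_eq -cd -mulrDr addrC subrK mulr1.
have uv : two_sided_inverse (c - 1) (b - 1).
  split; first by rewrite -ca mulrBr mulr1 -mulrA ab mulr1 ca opprB addrC subrK.
  by rewrite -ac mulrBl mul1r mulrA ba mul1r ac opprB addrC subrK.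
have sq : (c - 1) ^+ 2 = c ^+ 2 * a ^+ 2.
  by rewrite -{1}ca exprMn_comm // /GRing.comm ca ac.
have := h_inverse _ _ uv.
rewrite (raddfB h) (raddfB eta) inverse_identity_one eta1 !subr0.
rewrite sq -scalerA -(h_inverse a b) //.
rewrite (h_inverse c (1 - a)) // raddfB eta1 sub0r => hc.
have /(congr1 (fun m => (1 - a) ^+ 2 *: m)) := esym hc.
have dc2 : (1 - a) ^+ 2 * c ^+ 2 = 1.
  by rewrite !expr2 mulrA -[X in X * c]mulrA dc mulr1 dc.
by rewrite !scalerA dc2 !scale1r.
Qed.

Lemma additive_natr (f : {additive A -> V}) n : f 1 = 0 -> f n%:R = 0.
Proof. by move=> f1; rewrite raddfMn f1 mul0rn. Qed.

Context (shift : forall a : A, exists n : nat,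
  (exists v, two_sided_inverse (a + n%:R) v) /\
  (exists v, two_sided_inverse (a + n.+1%:R) v)).

(** The element e = a + (n + 1) is invertible, and so is 1 - e = - (a + n):
    this is why shifts by two consecutive integers are requested. *)
Lemma shift_inverses (a : A) : exists n b c,
  two_sided_inverse (a + n%:R) b /\ two_sided_inverse (1 - (a + n%:R)) c.
Proof.
have [n [[v [uv vu]] [w Iw]]] := shift a.
exists n.+1, w, (- v); split=> //.
have -> : 1 - (a + n.+1%:R) = - (a + n%:R).
  by rewrite mulrS addrCA opprD addrA subrr add0r.
by split; rewrite mulrNN.
Qed.

(** Adding an integer changes neither side, which removes the invertibility
    conditions.  They have to be removed before the square is treated, as
    1 - a (1 - a) may fail to be invertible when a and 1 - a are. *)
Lemma inverse_identity_opp_all (a : A) : h a = - eta a.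
Proof.
have [n [b [c [Ib Ic]]]] := shift_inverses a.
have := inverse_identity_opp _ _ _ Ib Ic.
rewrite (raddfD h) (raddfD eta) !additive_natr ?addr0 //.
exact: inverse_identity_one.
Qed.

(** The inverse of p = a (1 - a) is b + c, so h(p) = (1 - a)^2 h(a) +
    a^2 h(1 - a); replacing h by - eta and eta(1 - a) by - eta(a) leaves
    eta(a) - eta(a^2) = ((1 - a)^2 - a^2) eta(a) = (1 - 2 a) eta(a). *)
Lemma inverse_identity_square (a b c : A) :
  two_sided_inverse a b -> two_sided_inverse (1 - a) c ->
  eta (a ^+ 2) = a *: eta a *+ 2.
Proof.
move=> Ia Id; have [[ab ba] [dc cd]] := (Ia, Id).
pose p := a * (1 - a).
have pE : p = (1 - a) * a by rewrite /p mulrBr mulrBl mulr1 mul1r.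
have Ip : two_sided_inverse p (b + c).
  have pb : p * b = 1 - a by rewrite pE -mulrA ab mulr1.
  have pc : p * c = a by rewrite -mulrA dc mulr1.
  have bp : b * p = 1 - a by rewrite mulrA ba mul1r.
  have cp : c * p = a by rewrite pE mulrA cd mul1r.
  by split; rewrite ?mulrDl ?mulrDr ?pb ?pc ?bp ?cp subrK.
have p2 : p ^+ 2 = (1 - a) ^+ 2 * a ^+ 2.
  by rewrite pE exprMn_comm.
have p2' : p ^+ 2 = a ^+ 2 * (1 - a) ^+ 2 by rewrite exprMn_comm.
have := h_inverse _ _ Ip.
rewrite (raddfD eta) scalerDr {1}p2 p2'.
rewrite -[in X in X + _]scalerA -[in X in _ + X]scalerA.
rewrite -(h_inverse a b) // -(h_inverse (1 - a) c) //.
rewrite !inverse_identity_opp_all (raddfB eta 1) eta1 sub0r opprK.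
rewrite /p mulrBr mulr1 -expr2.
have -> : (1 - a) ^+ 2 = a ^+ 2 - a *+ 2 + 1.
  by rewrite -[LHS]sqrrN opprB sqrrB1.
rewrite (raddfB eta a) opprB scalerN !scalerDl scaleNr scale1r -scalerMnl.
rewrite !opprD opprK addrAC => /addIr ->.
by rewrite addrAC addNr add0r.
Qed.

(** For the shifted element a + n both sides gain 2 n eta(a), and the previous
    identity applies to it. *)
Lemma inverse_identity_jordan (a : A) : eta (a ^+ 2) = a *: eta a *+ 2.
Proof.
have [n [b [c [Ib Ic]]]] := shift_inverses a.
have := inverse_identity_square _ _ _ Ib Ic.
rewrite (raddfD eta a) additive_natr // addr0.
have comm : GRing.comm a n%:R by apply: commr_nat.
rewrite exprDn_comm // !big_ord_recr big_ord0 /= add0r.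
rewrite !expr0 !mul1r mulr1 bin0 bin1 binn !expr1 !mulr1n -natrX.
rewrite !raddfD /= additive_natr // addr0 mulr_natr !raddfMn.
rewrite scalerDl scaler_nat mulrnDl.
by rewrite subn0 -mulr2n => /addIr.
Qed.
End InverseIdentity.

(** * Application to the bimodule *)

(** M is already a module over the scalars; an alias is needed to carry its
    structure of left module over A. *)
Definition left_module {K : numFieldType} {c : K -> K} {A : starAlgType c}
  (M : unitalStarBimodType A) : Type := M.

Section LeftModule.
Context {K : numFieldType} {c : K -> K} {A : starAlgType c}.
Context (M : unitalStarBimodType A).

HB.instance Definition _ := GRing.Zmodule.copy (left_module M) M.
HB.instance Definition _ := GRing.Zmodule_isLmodule.Build A (left_module M)
  (fun a b m => esym (lactA a b m)) (@lact1 K c A M) (fun a => lactDr a)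
  (fun m a b => lactDl a b m).
End LeftModule.

Lemma morph_addB (U V : zmodType) (f : U -> V) :
  {morph f : x y / x + y} -> zmod_morphism f.
Proof. by move=> fD x y; apply/eqP; rewrite eq_sym subr_eq -fD subrK. Qed.

Theorem theorem3p2 (R : realType) (k : ground_field)
    (A : banachStarAlgType (@scalar_conj R k)) (M : unitalStarBimodType A)
    (W : A) (delta : {linear A -> M}) :
  delta 1 = 0 ->
  (forall a b : A, a * star b = W ->
     delta W = lact a (mstar (delta b)) + lact (star b) (delta a)) ->
  jordan_left_derivation (fun a : A => lact W (delta a)).
Proof.
move=> delta1 hW.
pose V : lmodType A := left_module M.
pose eta (a : A) : V := lact W (delta a).
pose h (v : A) : V := v *: (delta W : V) - (mstar (delta (star (v * W))) : V).
have etaB : zmod_morphism eta.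
  by move=> a b; rewrite /eta raddfB; exact: (scalerBr (W : A) (delta a : V)).
have hB : zmod_morphism h.
  apply: morph_addB => a b; rewrite /h mulrDl starD raddfD mstarD opprD.
  by rewrite scalerDl addrACA.
pose etaA : {additive A -> V} :=
  HB.pack eta (GRing.isZmodMorphism.Build A V eta etaB).
pose hA : {additive A -> V} := HB.pack h (GRing.isZmodMorphism.Build A V h hB).
have h_inverse u v : two_sided_inverse u v -> hA u = u ^+ 2 *: etaA v.
  (* Of the factorizations of W, the pair v, u * W makes the term under the
     involution additive in u. *)
  move=> [uv vu] /=; have := hW v (star (u * W)).
  rewrite starK mulrA vu mul1r => /(_ erefl) hE.
  apply/eqP; rewrite subr_eq; apply/eqP.
  by rewrite [in LHS]hE [LHS]lactDr -!lactA uv lact1 addrC mulrA -expr2 lactA.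
have eta1 : etaA 1 = 0 by rewrite /= /eta delta1; exact: (scaler0 V).
split; first by move=> l a b; rewrite linearP lactDr lactZr.
move=> a; rewrite scaler_nat.
apply: (@inverse_identity_jordan A V etaA hA eta1 h_inverse).
by move=> x; apply: banach_shift; apply: scalars_archimedean.
Qed.
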